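(* Let $\mathcal{P}\subseteq\mathbb{R}^p$ be the parameter domain and $\mathcal{R}:\mathcal{P}\to\mathbb{R}^n$ the residual map (see the context). Assume: (i) for all $t=0,1,\dots,T$, the residual satisfies $\mathcal{R}(\theta_t)_i\ne 0$ for $i=1,2,\dots,n$, where $\theta_0,\dots,\theta_T\in\mathcal{P}$ are given parameters; (ii) $\mathcal{P}$ is open, convex and bounded; (iii) $\mathcal{R}$ is smooth and has bounded derivatives in $\mathcal{P}$. For $\Delta t>0$ and $g_t\sim N(0,I_n)$, let $\widehat\theta_{t+1}$, $K(\theta_t)$ and $\widehat K(\theta_t)$ be as defined in the context. Then there exists a constant $C>0$ such that for any $\Delta t>0$ it holds $$\mathbb{E}\left[\left\|\frac{\mathcal{R}(\widehat\theta_{t+1})-\mathcal{R}(\theta_t)}{\Delta t}-K(\theta_t)g_t\right\|\right]\le Cn\,\Delta t\qquad\text{and}\qquad\mathbb{E}\left[\left\|\frac{\mathcal{R}(\widehat\theta_{t+1})-\mathcal{R}(\theta_t)}{\Delta t}-K(\theta_t)g_t\right\|^2\right]\le C^2n(n+2)\,\Delta t^2.$$ In particular, $$\left\|\mathbb{E}\big[\widehat K(\theta_t)\big]-K(\theta_t)\right\|_F\le Cn(n+1)\,\Delta t\qquad\text{and}\qquad\left|\mathbb{E}\big[\operatorname{Tr}(\widehat K(\theta_t))\big]-\operatorname{Tr}(K(\theta_t))\right|\le Cn(n+1)\,\Delta t.$$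
   Context: $\|\cdot\|$ is the Euclidean norm of vectors, $\|\cdot\|_F$ the Frobenius norm, and $\operatorname{Tr}$ the trace. Residual map: $\mathcal{R}:\mathcal{P}\to\mathbb{R}^n$ is the residual of a physics-informed neural network $u_\theta:\Omega\subseteq\mathbb{R}^d\to\mathbb{R}$ with parameters $\theta\in\mathcal{P}$, approximating the solution of $\mathcal{D}u=f$ in $\Omega$, $\mathcal{B}u=g$ on $\partial\Omega$ ($\mathcal{D}$ a differential operator, $\mathcal{B}$ an operator defining boundary and possibly initial conditions). With interior collocation points $x_D^1,\dots,x_D^{n_D}$ and boundary points $x_B^1,\dots,x_B^{n_B}$, $n_D+n_B=n$, it is given by $\mathcal{R}(\theta)_i=\mathcal{D}u_\theta(x_D^i)-f(x_D^i)$ for $1\le i\le n_D$ and $\mathcal{R}(\theta)_i=\mathcal{B}u_\theta(x_B^{i-n_D})-g(x_B^{i-n_D})$ for $n_D+1\le i\le n$. (The boundary datum $g$ is unrelated to the random vector $g_t$.) $\nabla\mathcal{R}(\theta)=[\nabla\mathcal{R}_1(\theta)\ \cdots\ \nabla\mathcal{R}_n(\theta)]\in\mathbb{R}^{p\times n}$ is the transpose of the Jacobian, and $K(\theta)=\nabla\mathcal{R}(\theta)^\top\nabla\mathcal{R}(\theta)\in\mathbb{R}^{n\times n}$ is the neural tangent kernel. Single-sample estimator: for given $\theta_t$, $\Delta t>0$ and a standard Gaussian vector $g_t\sim N(0,I_n)$, set $\Lambda_{\mathrm{pred}}(\theta_t)=\operatorname{diag}(-g_t)\operatorname{diag}(\mathcal{R}(\theta_t))^{-1}$,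 where $\operatorname{diag}(v)$ is the diagonal matrix with diagonal $v$; $$\widehat\theta_{t+1}=\theta_t-\Delta t\,\nabla\mathcal{R}(\theta_t)\Lambda_{\mathrm{pred}}(\theta_t)\mathcal{R}(\theta_t);$$ $$\widetilde K(\theta_t)=\begin{pmatrix}\frac{\mathcal{R}(\widehat\theta_{t+1})-\mathcal{R}(\theta_t)}{\Delta t}(g_t)_1&\cdots&\frac{\mathcal{R}(\widehat\theta_{t+1})-\mathcal{R}(\theta_t)}{\Delta t}(g_t)_n\end{pmatrix}\in\mathbb{R}^{n\times n},\qquad\widehat K(\theta_t)=\frac{\widetilde K(\theta_t)+\widetilde K(\theta_t)^\top}{2}.$$ Expectations are over $g_t$, with $\theta_t$ given.
   Formalization: Since the updated parameter leaves the bounded domain P with positive probability, R(θ̂) is undefined there; the theorem takes R to be any Borel extension of the residual to all of R^p with at most quadratic growth. *)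

(* Defs.v *)
From HB Require Import structures.
From mathcomp Require Import all_boot all_order all_algebra.
From mathcomp Require Import all_classical all_reals all_analysis.

Set Implicit Arguments.
Unset Strict Implicit.
Unset Printing Implicit Defensive.

Import Order.TTheory GRing.Theory Num.Theory.
Import numFieldNormedType.Exports.

Local Open Scope classical_set_scope.
Local Open Scope ring_scope.

(* Vectors are column vectors.  The library norm `|v| on
   matrices is the sup norm, hence the explicit Euclidean/Frobenius norm. *)

Definition frob_norm (R : realType) (m n : nat) (A : 'M[R]_(m, n)) : R :=
  Num.sqrt (\sum_i \sum_j A i j ^+ 2).

Notation eucl_norm v := (@frob_norm _ _ 1 v).

Definition partial (R : realType) (p : nat) (i : 'I_p) (f : 'cV[R]_p -> R)
    : 'cV[R]_p -> R :=
  fun x => 'D_(delta_mx i 0 : 'cV[R]_p) f x.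

(* d^|s| f / dx_{s_0} dx_{s_1} ..., the last index of s being applied first. *)
Definition partials (R : realType) (p : nat) (s : seq 'I_p)
    (f : 'cV[R]_p -> R) : 'cV[R]_p -> R :=
  foldr (@partial R p) f s.

Definition component (R : realType) (p n : nat) (F : 'cV[R]_p -> 'cV[R]_n)
    (i : 'I_n) : 'cV[R]_p -> R :=
  fun x => F x i 0.

(* C^oo on the open set P: every iterated partial derivative of every
   component is Frechet differentiable at every point of P.  As P is open,
   these derivatives only depend on the restriction of F to P. *)
Definition smooth_on (R : realType) (p n : nat) (P : set 'cV[R]_p)
    (F : 'cV[R]_p -> 'cV[R]_n) : Prop :=
  forall (i : 'I_n) (s : seq 'I_p) (x : 'cV[R]_p), P x ->
    differentiable (partials s (component F i)) x.

(* The bound may depend on the derivative; order 0 is not included. *)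
Definition bounded_derivatives_on (R : realType) (p n : nat)
    (P : set 'cV[R]_p) (F : 'cV[R]_p -> 'cV[R]_n) : Prop :=
  forall (i : 'I_n) (s : seq 'I_p), s <> [::] ->
    exists M : R, forall x, P x -> `|partials s (component F i) x| <= M.

Definition boundary_set (R : realType) (d : nat) (Om : set 'cV[R]_d)
    : set 'cV[R]_d :=
  closure Om `\` interior Om.

(* A possibly nonlinear differential operator of some finite order m on Om:
   (D v)(x) is a function of x and of the partial derivatives of v at x of
   order at most m. *)
Definition differential_operator (R : realType) (d : nat)
    (Om : set 'cV[R]_d) (D : ('cV[R]_d -> R) -> 'cV[R]_d -> R) : Prop :=
  exists (m : nat) (F : 'cV[R]_d -> (seq 'I_d -> R) -> R),
    forall (v : 'cV[R]_d -> R) (x : 'cV[R]_d), Om x ->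
      D v x = F x (fun s => if (size s <= m)%N then partials s v x else 0).

Definition pinn_residual (R : realType) (d p nD nB : nat)
    (D B : ('cV[R]_d -> R) -> 'cV[R]_d -> R) (f g : 'cV[R]_d -> R)
    (xD : 'I_nD -> 'cV[R]_d) (xB : 'I_nB -> 'cV[R]_d)
    (u : 'cV[R]_p -> 'cV[R]_d -> R) (theta : 'cV[R]_p)
    : 'cV[R]_(nD + nB) :=
  col_mx (\col_i (D (u theta) (xD i) - f (xD i)))
         (\col_i (B (u theta) (xB i) - g (xB i))).

Definition borel_measurable (R : realType) (p n : nat)
    (F : 'cV[R]_p -> 'cV[R]_n) : Prop :=
  forall i : 'I_n,
    measurable_fun [set: g_sigma_algebraType (@open 'cV[R]_p)]
      (component F i).

Definition quadratic_growth (R : realType) (p n : nat)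
    (F : 'cV[R]_p -> 'cV[R]_n) : Prop :=
  exists A : R, forall x, eucl_norm (F x) <= A * (1 + eucl_norm x ^+ 2).

(* [residual_extension P r F]: F gives a meaning to the residual r, which is
   defined on P only, at every parameter.  A bounded P cannot contain the whole
   (unbounded) range of a nonconstant affine image of a Gaussian vector, so
   the residual does get evaluated outside P.  Every Borel extension of at
   most quadratic growth is allowed: extension by 0, bounded extensions,
   extensions with bounded second derivatives, ... *)
Definition residual_extension (R : realType) (p n : nat) (P : set 'cV[R]_p)
    (r F : 'cV[R]_p -> 'cV[R]_n) : Prop :=
  [/\ forall x, P x -> F x = r x, borel_measurable F & quadratic_growth F].

Section Estimator.
Variables (R : realType) (p n : nat) (F : 'cV[R]_p -> 'cV[R]_n).

(* Columns are the gradients of the components of F. *)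
Definition nabla (theta : 'cV[R]_p) : 'M[R]_(p, n) :=
  \matrix_(k, i) partial k (component F i) theta.

Definition ntk (theta : 'cV[R]_p) : 'M[R]_n :=
  (nabla theta)^T *m nabla theta.

(* diag_mx takes a row vector. *)
Definition Lambda_pred (theta : 'cV[R]_p) (g : 'cV[R]_n) : 'M[R]_n :=
  diag_mx (- g)^T *m invmx (diag_mx (F theta)^T).

Definition theta_hat (dt : R) (theta : 'cV[R]_p) (g : 'cV[R]_n) : 'cV[R]_p :=
  theta - dt *: (nabla theta *m Lambda_pred theta g *m F theta).

Definition diff_quot (dt : R) (theta : 'cV[R]_p) (g : 'cV[R]_n) : 'cV[R]_n :=
  dt^-1 *: (F (theta_hat dt theta g) - F theta).

Definition K_tilde (dt : R) (theta : 'cV[R]_p) (g : 'cV[R]_n) : 'M[R]_n :=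
  \matrix_(i, j) (diff_quot dt theta g i 0 * g j 0).

Definition K_hat (dt : R) (theta : 'cV[R]_p) (g : 'cV[R]_n) : 'M[R]_n :=
  2^-1 *: (K_tilde dt theta g + (K_tilde dt theta g)^T).

End Estimator.

Section Gaussian.
Context (d : measure_display) (S : measurableType d) (R : realType).
Variables (Pr : probability S R) (n : nat).

Definition mutually_independent (X : 'I_n -> {RV Pr >-> R}) : Prop :=
  forall (J : {set 'I_n}) (B : 'I_n -> set R),
    (forall i, measurable (B i)) ->
    Pr (\bigcap_(i in [set` J]) (X i @^-1` B i)) =
    (\prod_(i in J) Pr (X i @^-1` B i))%E.

(* Second parameter of normal_prob: the standard deviation. *)
Definition standard_gaussian (X : 'I_n -> {RV Pr >-> R}) : Prop :=
  mutually_independent X /\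
  forall (i : 'I_n) (B : set R), measurable B ->
    distribution Pr (X i) B = normal_prob 0 1 B.

Definition random_vector (X : 'I_n -> {RV Pr >-> R}) (w : S) : 'cV[R]_n :=
  \col_i X i w.

Definition mx_integrable (A : S -> 'M[R]_n) : Prop :=
  forall i j, Pr.-integrable [set: S] (fun w => (A w i j)%:E).

(* Meaningful only for A satisfying mx_integrable, because of [fine]. *)
Definition mx_expectation (A : S -> 'M[R]_n) : 'M[R]_n :=
  \matrix_(i, j) fine ('E_Pr[fun w => A w i j])%E.

End Gaussian.

(* Main.v *)
From HB Require Import structures.
Require Import Defs.
From mathcomp Require Import all_boot all_order all_algebra.
From mathcomp Require Import all_classical all_reals all_analysis.
From mathcomp Require Import measurable_realfun.
From mathcomp Require Import ring lra.

Import Order.TTheory GRing.Theory Num.Theory.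
Import numFieldNormedType.Exports.

Local Open Scope classical_set_scope.
Local Open Scope ring_scope.

(** Write [h = dt * (nabla g)], so that [theta_hat = theta + h] because no
    component of the residual vanishes at [theta].  The error
    [diff_quot - K g] is then [dt^-1] times the first-order Taylor remainder
    of the residual at [theta] for the increment [h].

    That remainder is at most [c |h|^2] for every increment, whether or not
    [theta + h] stays in [P] ([quadratic_remainder]).  Inside [P], which is
    convex, this is Taylor's inequality with bounded second derivatives.
    Outside [P], which is open, [|h|] is bounded below by some [r > 0]; hence
    [1 <= |h|^2 / r^2], and a function of quadratic growth minus its
    linearization is again [O(|h|^2)].  Dividing by [dt] gives the pointwise
    bound [|diff_quot - K g| <= c dt |g|^2] ([diff_quot_error]), and there are
    only finitely many parameters [theta t], so one constant serves them all.

    What remains is Gaussian moments.  As the constant may depend on [n], the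
    only exact values needed are [E[g_i g_j] = delta_ij]
    ([integral_gaussian_mul]), which gives both [E |g|^2 = n] and
    [E[(K g) g^T] = K]; the fourth moment only has to be finite, since
    [|g|^4 <= n \sum_i g_i^4] and [|g|^3 <= |g|^2 + |g|^4].  The first two
    bounds are the expectations of the pointwise bound and of its square.
    For the last two, [E K_hat - K] is the symmetric part of the matrix
    [E[e g^T]], where [e] is the error; the entries of that matrix are at most
    [c dt E |g|^3] ([symmetrized_product_expectation]). *)

(** * Moments of the standard normal law *)

Section standard_normal.
Context {R : realType}.
Local Notation mu := (@lebesgue_measure R).
Local Notation phi := (@normal_pdf R 0 1).
Local Notation N01 := (@normal_prob R 0 1).

(** The density of the normal law is a version of its Radon-Nikodym derivative
    with respect to Lebesgue measure, so integrals can be moved to the latter,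
    where calculus is available. *)
Lemma ge0_integral_normal_prob (m s : R) (f : R -> \bar R) :
  (forall x, 0 <= f x)%E -> measurable_fun [set: R] f ->
  (\int[normal_prob m s]_x f x = \int[mu]_x (f x * (normal_pdf m s x)%:E))%E.
Proof.
move=> f0 mf.
have dom : normal_prob m s `<< mu := normal_prob_dominates m s.
rewrite -(Radon_Nikodym_SigmaFinite.change_of_variables dom)//.
have iRN := Radon_Nikodym_SigmaFinite.f_integrable dom.
have mpdf : measurable_fun [set: R] (EFin \o normal_pdf m s).
  by apply/measurable_EFinP; exact: measurable_normal_pdf.
apply: ae_eq_integral => //.
- by apply: emeasurable_funM => //; exact: measurable_int iRN.
- exact: emeasurable_funM.
apply: ae_eqe_mul2l; apply: integral_ae_eq => // E _ mE.
by rewrite -Radon_Nikodym_SigmaFinite.f_integral.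
Qed.

Lemma normal_pdf01E (x : R) :
  phi x = @normal_peak R 1 * expR (- (x ^+ 2) / 2).
Proof.
by rewrite normal_pdfE ?oner_eq0// /normal_fun subr0 expr1n.
Qed.

Lemma normal_pdf01_even (x : R) : phi (- x) = phi x.
Proof. by rewrite !normal_pdf01E sqrrN. Qed.

Lemma measurable_exprM_normal_pdf k :
  measurable_fun [set: R] (fun x : R => x ^+ k * phi x).
Proof.
apply: measurable_funM; first exact: exprn_measurable.
exact: measurable_normal_pdf.
Qed.

(** [exp(x^2/4) >= (x^2/4)^2/2] bounds [x^4 exp(-x^2/2)] by
    [32 exp(-x^2/4)], a multiple of the normal density of variance 2. *)
Lemma integrable_expr4_normal_pdf :
  mu.-integrable [set: R] (fun x : R => (x ^+ 4 * phi x)%:E).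
Proof.
pose s : R := Num.sqrt 2; have s2 : s ^+ 2 = 2 by rewrite sqr_sqrtr.
have s0 : s != 0 by rewrite gt_eqF// sqrtr_gt0.
pose c : R := 32 * @normal_peak R 1 * (@normal_peak R s)^-1.
have /(integrableZl measurableT c) := integrable_normal_pdf 0 s.
apply: le_integrable => //.
  by apply/measurable_EFinP; exact: measurable_exprM_normal_pdf.
move=> x _; rewrite -EFinM !abse_EFin lee_fin !ger0_norm; last 2 first.
- rewrite mulr_ge0 ?normal_pdf_ge0//.
  by rewrite !mulr_ge0 ?normal_peak_ge0 ?invr_ge0 ?normal_peak_ge0.
- by rewrite mulr_ge0 ?normal_pdf_ge0// exprn_even_ge0.
rewrite normal_pdf01E (normal_pdfE _ s0) /normal_fun subr0 s2 /c.
rewrite [leRHS]mulrA divfK; last by rewrite gt_eqF// normal_peak_gt0.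
rewrite mulrCA -[leRHS]mulrA [leRHS]mulrCA ler_wpM2l ?normal_peak_ge0//.
have -> : - x ^+ 2 / 2 = - (x ^+ 2 / 4) + - x ^+ 2 / (2 *+ 2) by field.
rewrite expRD mulrA mulrC [leRHS]mulrC ler_wpM2l ?expR_ge0//.
rewrite expRN ler_pdivrMr ?expR_gt0//.
have y0 : 0 <= x ^+ 2 / 4 by rewrite mulr_ge0 ?sqr_ge0.
have := @expR_ge1Dxn R _ 1 y0.
rewrite (_ : 2`!%:R = 2 :> R)// => h.
have -> : x ^+ 4 = 32 * ((x ^+ 2 / 4) ^+ 2 / 2) by field.
by rewrite ler_wpM2l//; apply: le_trans h; rewrite lerDr.
Qed.

(** Folding the line onto a half-line reduces even and odd moments to
    integrals over the nonnegative reals. *)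
Lemma ge0_integralT_half (G : R -> R) : (forall x, 0 <= G x) -> continuous G ->
  (\int[mu]_x (G x)%:E =
   \int[mu]_(x in `[0%R, +oo[) (G x)%:E +
   \int[mu]_(x in `[0%R, +oo[) (G (- x))%:E)%E.
Proof.
move=> G0 cG; have mG : measurable_fun [set: R] G.
  exact: continuous_measurable_fun.
rewrite -(setUv `[0%R, +oo[) ge0_integral_setU//=; last 4 first.
- exact: measurableC.
- exact/measurable_EFinP/measurable_funTS.
- by move=> x _; rewrite lee_fin.
- exact/disj_setPCl.
congr +%E; rewrite setCitvr.
rewrite integral_itv_bndo_bndc; last exact/measurable_EFinP/measurable_funTS.
rewrite -{1}oppr0 ge0_integration_by_substitutionNy//.
exact: continuous_subspaceT.
Qed.

Lemma is_derive_xnormal_pdf (x : R) :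
  is_derive x 1 (fun y : R => y * phi y) ((1 - x ^+ 2) * phi x).
Proof.
have dphi : is_derive x 1 phi (- x * phi x).
  rewrite (_ : phi = fun y => @normal_peak R 1 * expR (- (y ^+ 2) / 2));
      last first.
    by apply/funext => y; rewrite normal_pdf01E.
  have d1 : is_derive x 1 (fun y : R => - (y ^+ 2) / 2) (- x).
    by apply: is_derive_eq; rewrite /GRing.scale/=; field.
  have d2 : is_derive x 1 (fun y : R => expR (- (y ^+ 2) / 2))
      (expR (- (x ^+ 2) / 2) * - x).
    by apply: (@is_derive1_comp _ expR (fun y : R => - (y ^+ 2) / 2)).
  apply: is_derive_eq; rewrite /GRing.scale/=; ring.
apply: is_derive_eq; rewrite /GRing.scale/=; ring.
Qed.

Lemma cvg_xnormal_pdf : (fun y : R => y * phi y) x @[x --> +oo] --> (0 : R).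
Proof.
apply/cvgrPdist_le => e e0; near=> x.
have x0 : 0 < x by near: x; exact: nbhs_pinfty_gt.
rewrite sub0r normrN ger0_norm; last by rewrite mulr_ge0 ?normal_pdf_ge0 ?ltW.
have xe : 2 * @normal_peak R 1 / e <= x.
  by near: x; apply: nbhs_pinfty_ge; exact: num_real.
rewrite normal_pdf01E mulNr expRN mulrA ler_pdivrMr ?expR_gt0//.
have := expR_ge1Dx (x ^+ 2 / 2).
rewrite ler_pdivrMr// in xe => h.
apply: (@le_trans _ _ (e * (x ^+ 2 / 2))); last first.
  by rewrite ler_pM2l//; apply: le_trans h; rewrite lerDr.
rewrite (_ : e * _ = x / 2 * (x * e)); last by field.
rewrite (_ : x * normal_peak 1 = x / 2 * (2 * normal_peak 1)); last by field.
by rewrite ler_pM2l// divr_gt0.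
Unshelve. all: by end_near. Qed.

Lemma continuous_exprM_normal_pdf k : continuous (fun x : R => x ^+ k * phi x).
Proof.
move=> x; apply: cvgM; first exact: exprn_continuous.
by apply: continuous_normal_pdf; rewrite oner_eq0.
Qed.

Lemma integrable_exprM_normal_pdf k : (k <= 4)%N ->
  mu.-integrable [set: R] (fun x : R => (x ^+ k * phi x)%:E).
Proof.
move=> k4.
have := integrableD measurableT (integrable_normal_pdf 0 1)
  integrable_expr4_normal_pdf.
apply: le_integrable => //.
  by apply/measurable_EFinP; exact: measurable_exprM_normal_pdf.
move=> x _; rewrite -EFinD !abse_EFin lee_fin.
have x4 : 0 <= x ^+ 4 by exact: exprn_even_ge0.
rewrite -[X in `|X + _|]mul1r -mulrDl !normrM.
rewrite ler_wpM2r// [leRHS]ger0_norm ?addr_ge0// normrX.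
rewrite -(ger0_norm x4) normrX.
have [x1|/ltW x1] := leP `|x| 1.
  by rewrite (@le_trans _ _ 1)//; [exact: exprn_ile1|rewrite lerDl exprn_ge0].
by rewrite (@le_trans _ _ (`|x| ^+ 4))//; [exact: ler_weXn2l|rewrite lerDr].
Qed.

(** The difference [(1 - x^2) phi] of the two integrands is the derivative of
    [x phi], which vanishes at 0 and at infinity. *)
Lemma integral0y_second_moment :
  (\int[mu]_(x in `[0%R, +oo[) (x ^+ 2 * phi x)%:E =
   \int[mu]_(x in `[0%R, +oo[) (phi x)%:E)%E.
Proof.
pose f (x : R) : R := (1 - x ^+ 2) * phi x; pose F x : R := x * phi x.
have Fd (x : R) : (F^`()%classic) x = f x.
  by rewrite derive1E; have [_] := is_derive_xnormal_pdf x.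
have dF (x : R) : derivable F x 1 by have [] := is_derive_xnormal_pdf x.
have cF : continuous F.
  by move=> x; exact/differentiable_continuous/derivable1_diffP.
have cf : continuous f.
  move=> x; apply: cvgM; last first.
    by apply: continuous_normal_pdf; rewrite oner_eq0.
  by apply: cvgB; [exact: cvg_cst|exact: exprn_continuous].
have mf : measurable_fun [set: R] (EFin \o f).
  by apply/measurable_EFinP; exact: continuous_measurable_fun.
(* The integrand changes sign at 1; beyond 1 it is nonpositive, as the
   fundamental theorem of calculus on a half-line requires. *)
have I1 : (\int[mu]_(x in `[0%R, 1%R]) (f x)%:E = (F 1)%:E - (F 0)%:E)%E.
  apply: continuous_FTC2 => //.
  - exact: continuous_subspaceT.
  - split => //.
      by apply: cvg_at_right_filter; exact: cF.
    by apply: cvg_at_left_filter; exact: cF.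
have I2 : (\int[mu]_(x in `[1%R, +oo[) (f x)%:E = 0%:E - (F 1)%:E)%E.
  apply: le0_continuous_FTC2y => //.
  - move=> x x1; rewrite mulr_le0_ge0 ?normal_pdf_ge0// subr_le0.
    by rewrite expr_ge1// (le_trans _ x1).
  - exact: continuous_subspaceT.
  - exact: cvg_xnormal_pdf.
  - by apply: cvg_at_right_filter; exact: cF.
have I : (\int[mu]_(x in `[0%R, +oo[) (f x)%:E = 0)%E.
  rewrite (@itv_bndbnd_setU _ _ _ (BLeft (1 : R)))//; last by rewrite bnd_simp.
  rewrite integral_setU//=; last 2 first.
  - exact: measurable_funTS.
  - apply/disj_setPS => x [/=]; rewrite !in_itv/= andbT => /andP[_ x1].
    by rewrite leNgt x1.
  rewrite integral_itv_bndo_bndc; last exact: measurable_funTS.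
  rewrite [X in (X + _)%E]I1 [X in (_ + X)%E]I2 -!EFinB -EFinD.
  by rewrite /F mul0r; congr EFin; ring.
have i0 : mu.-integrable `[0%R, +oo[ (fun x => (phi x)%:E).
  by apply: integrableS (integrable_normal_pdf 0 1).
have i2 : mu.-integrable `[0%R, +oo[ (fun x => (x ^+ 2 * phi x)%:E).
  by apply: integrableS (@integrable_exprM_normal_pdf 2 isT).
move: I; under eq_integral do rewrite /f mulrBl mul1r EFinB.
rewrite integralB//=.
have := integrable_fin_num _ i0; have := integrable_fin_num _ i2.
move=> /(_ (measurable_itv _)) /fineK <- /(_ (measurable_itv _)) /fineK <-.
by rewrite -EFinB => -[] /eqP; rewrite subr_eq0 => /eqP ->.
Qed.

Lemma integral_second_moment : (\int[mu]_x (x ^+ 2 * phi x)%:E = 1)%E.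
Proof.
rewrite -(integral_normal_pdf 0 1) ge0_integralT_half; last 2 first.
- by move=> x; rewrite mulr_ge0 ?normal_pdf_ge0 ?sqr_ge0.
- exact: continuous_exprM_normal_pdf.
rewrite [RHS]ge0_integralT_half; last 2 first.
- by move=> x; rewrite normal_pdf_ge0.
- by apply: continuous_normal_pdf; rewrite oner_eq0.
under [X in (_ + X)%E = _]eq_integral do rewrite normal_pdf01_even sqrrN.
under [X in _ = (_ + X)%E]eq_integral do rewrite normal_pdf01_even.
by rewrite integral0y_second_moment.
Qed.

Lemma integrable_exprn_normal_prob k : (k <= 4)%N ->
  N01.-integrable [set: R] (fun x : R => (x ^+ k)%:E).
Proof.
move=> k4; have mk : measurable_fun [set: R] (fun x : R => (x ^+ k)%:E).
  by apply/measurable_EFinP; exact: exprn_measurable.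
apply/integrableP; split=> //.
rewrite ge0_integral_normal_prob//; last exact: measurableT_comp.
have /integrableP[_] := @integrable_exprM_normal_pdf k k4.
apply: le_lt_trans; apply: ge0_le_integral => //.
- by move=> x _; rewrite mule_ge0// lee_fin normal_pdf_ge0.
- apply: emeasurable_funM; first exact: measurableT_comp.
  by apply/measurable_EFinP; exact: measurable_normal_pdf.
- apply: measurableT_comp => //; apply/measurable_EFinP.
  exact: measurable_exprM_normal_pdf.
- move=> x _; rewrite /= lee_fin normrM.
  by rewrite [`|phi x|]ger0_norm ?normal_pdf_ge0.
Qed.

Lemma normal_prob_second_moment : (\int[N01]_x (x ^+ 2)%:E = 1)%E.
Proof.
rewrite ge0_integral_normal_prob//; last 2 first.
- by move=> x; rewrite lee_fin sqr_ge0.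
- by apply/measurable_EFinP; exact: exprn_measurable.
exact: integral_second_moment.
Qed.

(** By symmetry of the density, the positive and negative parts of the identity
    have the same (finite) integral. *)
Lemma normal_prob_mean : (\int[N01]_x x%:E = 0)%E.
Proof.
have ix : N01.-integrable [set: R] (EFin : R -> \bar R).
  exact: (@integrable_exprn_normal_prob 1 isT).
have mx : measurable_fun [set: R] (EFin : R -> \bar R) := measurable_int _ ix.
pose pos (x : R) := Num.max x 0.
have cpos : continuous (fun x : R => pos x * phi x).
  move=> x; apply: cvgM; last by apply: continuous_normal_pdf; rewrite oner_eq0.
  by apply: continuous_max; [exact: cvg_id|exact: cvg_cst].
have cneg : continuous (fun x : R => pos (- x) * phi x).
  move=> x; apply: cvgM; last by apply: continuous_normal_pdf; rewrite oner_eq0.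
  by apply: continuous_max; [apply: cvgN; exact: cvg_id|exact: cvg_cst].
have pos0 x : 0 <= pos x by rewrite le_max lexx orbT.
rewrite integralE !ge0_integral_normal_prob//; last 2 first.
- exact: measurable_funeneg.
- exact: measurable_funepos.
suff -> : (\int[mu]_x (EFin^\+ x * (phi x)%:E) =
           \int[mu]_x (EFin^\- x * (phi x)%:E))%E.
  rewrite subee// -ge0_integral_normal_prob//; last exact: measurable_funeneg.
  exact: integrable_neg_fin_num ix.
transitivity (\int[mu]_x (pos x * phi x)%:E)%E.
  by apply: eq_integral => x _; rewrite funeposE -EFin_max -EFinM.
transitivity (\int[mu]_x (pos (- x) * phi x)%:E)%E; last first.
  by apply: eq_integral => x _; rewrite funenegE -EFinN -EFin_max -EFinM.
rewrite ge0_integralT_half//; last first.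
  by move=> x; rewrite mulr_ge0 ?normal_pdf_ge0.
rewrite [RHS]ge0_integralT_half//; last first.
  by move=> x; rewrite mulr_ge0 ?normal_pdf_ge0.
rewrite addeC; congr +%E; apply: eq_integral => x _.
  by rewrite normal_pdf01_even.
by rewrite normal_pdf01_even opprK.
Qed.

End standard_normal.

(** * Independence and measurability *)

Section independence.
Context {d} {S : measurableType d} {R : realType} (Pr : probability S R).

(** Independence says that the joint law agrees with the product law on
    rectangles, hence everywhere; Fubini then splits the integral. *)
Lemma integral_independent_mul (X Y : {RV Pr >-> R}) :
  (forall A B : set R, measurable A -> measurable B ->
     Pr (X @^-1` A `&` Y @^-1` B) = (Pr (X @^-1` A) * Pr (Y @^-1` B))%E) ->
  Pr.-integrable [set: S] (EFin \o X) -> Pr.-integrable [set: S] (EFin \o Y) ->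
  Pr.-integrable [set: S] (fun w => (X w * Y w)%:E) ->
  (\int[Pr]_w (X w * Y w)%:E = \int[Pr]_w (X w)%:E * \int[Pr]_w (Y w)%:E)%E.
Proof.
move=> indep iX iY iXY.
have mZ : measurable_fun [set: S] (fun w => (X w, Y w)).
  by apply: measurable_fun_pair.
pose Z : {mfun S >-> (R * R)%type} :=
  HB.pack (fun w => (X w, Y w)) (isMeasurableFun.Build _ _ _ _ _ mZ).
pose PX : probability R R := distribution Pr X.
pose PY : probability R R := distribution Pr Y.
have PZ (A : set (R * R)) : measurable A ->
    (PX \x PY)%E A = distribution Pr Z A.
  by apply: product_measure_unique => A1 A2 mA1 mA2; rewrite -indep.
pose f (z : R * R) : \bar R := (z.1 * z.2)%:E.
have mf : measurable_fun [set: R * R] f.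
  by apply/measurable_EFinP; apply: measurable_funM.
have mE : measurable_fun [set: R] (EFin : R -> \bar R).
  exact/measurable_EFinP.
have iXd : PX.-integrable [set: R] (EFin : R -> \bar R).
  exact: integrable_pushforward.
have iYd : PY.-integrable [set: R] (EFin : R -> \bar R).
  exact: integrable_pushforward.
have iZ : (PX \x PY)%E.-integrable [set: R * R] f.
  have /integrableP[_ h] : (distribution Pr Z).-integrable [set: R * R] f.
    exact: integrable_pushforward.
  apply/integrableP; split=> //; apply: le_lt_trans h.
  by rewrite (eq_measure_integral (distribution Pr Z))// => A mA _; exact: PZ.
transitivity (\int[distribution Pr Z]_z f z)%E.
  by rewrite (@integral_distribution _ _ _ _ _ _ Z _ mf iXY).
rewrite (eq_measure_integral (PX \x PY)%E); last first.
  by move=> A mA _; apply/esym; exact: PZ.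
rewrite -(integral12_prod_meas1 iZ).
transitivity (\int[PX]_x (x%:E * \int[PY]_y y%:E))%E.
  by apply: eq_integral => x _; rewrite -integralZl.
have fY := integrable_fin_num measurableT iYd.
rewrite -(fineK fY) integralZr// (fineK fY).
by congr (_ * _)%E; rewrite integral_distribution.
Qed.

End independence.

(** An open set of vectors is the union of the open boxes with rational corners
    that it contains: there are countably many, and membership in a box is a
    condition on coordinates. *)
Lemma measurable_cV_open {d} {S : measurableType d} {R : realType} {p : nat}
  (Y : S -> 'cV[R]_p) :
  (forall i, measurable_fun [set: S] (fun w => Y w i 0)) ->
  measurable_fun [set: S] (Y : S -> g_sigma_algebraType (@open 'cV[R]_p)).
Proof.
move=> mY.
apply: (@measurability _ _ _ (g_sigma_algebraType (@open 'cV[R]_p)) _ _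
  (@open 'cV[R]_p)) => // _ [U oU <-].
rewrite setTI.
pose box (q : 'cV[rat]_p * 'cV[rat]_p) : set 'cV[R]_p :=
  [set x | forall i, x i 0 \in `]ratr (q.1 i 0), ratr (q.2 i 0)[].
have mbox q : measurable (Y @^-1` box q).
  rewrite (_ : _ @^-1` _ = \bigcap_(i in [set: 'I_p])
    ((fun w => Y w i 0) @^-1` `]ratr (q.1 i 0), ratr (q.2 i 0)[)); last first.
    by apply/seteqP; split => w /= h => [i _|i]; [exact: h|exact: h].
  apply: fin_bigcap_measurable => //= i _.
  by rewrite -[X in measurable X]setTI; exact: mY.
rewrite (_ : U = \bigcup_(q in [set q | box q `<=` U]) box q); last first.
  apply/seteqP; split => [x Ux|x [q]]; last exact.
  have /nbhs_ballP[e /= e0 xeU] : nbhs x U by exact: open_nbhs_nbhs.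
  have /choice[a xa] i : exists q : rat, ratr q \in `]x i 0 - e, x i 0[.
    by apply: rat_in_itvoo; rewrite ltrBlDr ltrDl.
  have /choice[b xb] i : exists q : rat, ratr q \in `]x i 0, x i 0 + e[.
    by apply: rat_in_itvoo; rewrite ltrDl.
  exists (\col_i a i, \col_i b i) => /=; last first.
    move=> i /=; rewrite !mxE in_itv/=.
    by move: (xa i) (xb i); rewrite !in_itv/= => /andP[_ ->] /andP[].
  move=> y yab; apply: xeU; split=> // i j; rewrite ord1.
  move: (xa i) (xb i) (yab i); rewrite !mxE !in_itv/=.
  move=> /andP[h1 h2] /andP[h3 h4] /andP[h5 h6].
  by rewrite /ball/= ltr_distlC; apply/andP; split; lra.
rewrite preimage_bigcup bigcup_mkcond.
apply: countable_bigcupT_measurable; first exact: countableP.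
by move=> q; case: ifP.
Qed.

(** * Taylor's inequality on a convex set *)

Section taylor.
Context {R : realType} {p : nat}.
Implicit Types (f : 'cV[R]_p -> R) (P : set 'cV[R]_p) (x h : 'cV[R]_p).

Lemma derive_partialE f x h : differentiable f x ->
  'D_h f x = \sum_k h k 0 * partial k f x.
Proof.
move=> df; rewrite deriveE//.
rewrite [in LHS](_ : h = \sum_k h k 0 *: delta_mx k 0); last first.
  by rewrite [LHS]matrix_sum_delta; apply: eq_bigr => k _; rewrite big_ord1.
rewrite linear_sum; apply: eq_bigr => k _.
by rewrite linearZ /partial deriveE.
Qed.

Lemma convex_set_segment P x h (s : R) : convex_set P -> P x -> P (x + h) ->
  0 <= s <= 1 -> P (x + s *: h).
Proof.
move=> cP Px Pxh /andP[s0 s1].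
have /set_mem := cP (x + h) x (Itv01 s0 s1) (mem_set Pxh) (mem_set Px).
suff E : s *: (x + h) + (1 - s) *: x = x + s *: h by rewrite -E.
by rewrite scalerDr scalerBl scale1r addrAC [s *: x + _]addrC subrK.
Qed.

(** The mean value theorem for [s |-> f (x + s h)], with the derivative
    expanded into partial derivatives so that it can be applied again to each
    of them. *)
Lemma MVT_segment_partial f P x h : convex_set P -> P x -> P (x + h) ->
  (forall y, P y -> differentiable f y) ->
  exists s : R, [/\ 0 <= s <= 1, P (x + s *: h) &
    f (x + h) - f x = \sum_k h k 0 * partial k f (x + s *: h)].
Proof.
move=> cP Px Pxh df; pose phi (s : R) := f (x + s *: h).
have Pseg (s : R) : s \in `[0, 1] -> P (x + s *: h).
  by rewrite in_itv => s01; exact: convex_set_segment.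
have dphi (s : R) : s \in `[0, 1] -> is_derive s 1 phi ('D_h f (x + s *: h)).
  move=> s01; have dfs := diff_derivable (v := h) (df _ (Pseg _ s01)).
  (* Both difference quotients are the same function of the increment. *)
  have E : (fun t : R => t^-1 *: ((phi \o shift s) (t *: (1 : R)) - phi s)) =
    (fun t : R =>
      t^-1 *: ((f \o shift (x + s *: h)) (t *: h) - f (x + s *: h))).
    apply/funext => t; rewrite /phi /= /shift /=.
    by rewrite [t *: 1]mulr1 scalerDl addrCA.
  by split; rewrite /derivable /derive E.
have [s s01 e] : exists2 s : R, s \in `[0, 1] &
    phi 1 - phi 0 = 'D_h f (x + s *: h) * (1 - 0).
  have oo_cc (s : R) : s \in `]0, 1[ -> s \in `[0, 1].
    by rewrite !in_itv/= => /andP[s0 s1]; rewrite !ltW.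
  have dphi_oo (s : R) (s01 : s \in `]0, 1[) := dphi s (oo_cc s s01).
  have cphi : {within `[0, 1], continuous phi}.
    by apply: derivable_within_continuous => s /dphi[].
  exact: (MVT_segment ler01 dphi_oo cphi).
exists s; split; [by rewrite in_itv in s01|exact: Pseg|].
rewrite -derive_partialE; last exact/df/Pseg.
by move: e; rewrite /phi scale1r scale0r addr0 subr0 mulr1.
Qed.

(** The remainder is [\sum_k h_k (f_k (x + s h) - f_k x)] for one [s]
    between 0 and 1, with [f_k] the partial derivatives; the mean value theorem
    for each [f_k] brings in the second derivatives. *)
Lemma taylor1_remainder f P x h (M : R) : convex_set P -> P x -> P (x + h) ->
  (forall y, P y -> differentiable f y) ->
  (forall k y, P y -> differentiable (partial k f) y) ->
  (forall k l y, P y -> `|partial l (partial k f) y| <= M) ->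
  `|f (x + h) - f x - \sum_k h k 0 * partial k f x|
     <= M * (\sum_k `|h k 0|) ^+ 2.
Proof.
move=> cP Px Pxh df dpf ubM.
have [s [/andP[s0 s1] Ps ->]] := MVT_segment_partial _ _ _ _ cP Px Pxh df.
have dpartial k : `|partial k f (x + s *: h) - partial k f x|
    <= M * \sum_l `|h l 0|.
  have [r [_ Pr ->]] := MVT_segment_partial _ _ _ _ cP Px Ps (dpf k).
  rewrite mulr_sumr (le_trans (ler_norm_sum _ _ _))//; apply: ler_sum => l _.
  rewrite !mxE normrM normrM mulrC ler_pM ?mulr_ge0// ?ubM//.
  by rewrite ler_piMl// ger0_norm.
rewrite -sumrB expr2 mulrA mulr_sumr (le_trans (ler_norm_sum _ _ _))//.
apply: ler_sum => k _; rewrite -mulrBr normrM mulrC.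
by rewrite ler_wpM2r.
Qed.

End taylor.

(** * The remainder of the residual, inside and outside the domain *)

Section eucl_norm.
Context {R : realType}.

Lemma frob_norm_ge0 {m n} (A : 'M[R]_(m, n)) : 0 <= frob_norm A.
Proof. exact: sqrtr_ge0. Qed.

Lemma sqr_frob_norm {m n} (A : 'M[R]_(m, n)) :
  frob_norm A ^+ 2 = \sum_i \sum_j A i j ^+ 2.
Proof.
by rewrite sqr_sqrtr//; do 2 apply: sumr_ge0 => ? _; exact: sqr_ge0.
Qed.

Lemma sqr_eucl_norm {n} (v : 'cV[R]_n) : eucl_norm v ^+ 2 = \sum_i v i 0 ^+ 2.
Proof.
by rewrite sqr_frob_norm; apply: eq_bigr => i _; rewrite big_ord1.
Qed.

Lemma normr_le_frob_norm {m n} (A : 'M[R]_(m, n)) i j :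
  `|A i j| <= frob_norm A.
Proof.
rewrite -(ger0_norm (frob_norm_ge0 A)) -ler_sqr ?nnegrE//.
rewrite !real_normK ?num_real//.
rewrite sqr_frob_norm (bigD1 i)//= (bigD1 j)//= -addrA lerDl.
rewrite addr_ge0// sumr_ge0// => k _; first exact: sqr_ge0.
by apply: sumr_ge0 => l _; exact: sqr_ge0.
Qed.

Lemma frob_norm_le_sum {m n} (A : 'M[R]_(m, n)) :
  frob_norm A <= \sum_i \sum_j `|A i j|.
Proof.
have S0 : 0 <= \sum_i \sum_j `|A i j| by do 2 apply: sumr_ge0 => ? _.
rewrite -ler_sqr ?nnegrE// ?frob_norm_ge0// sqr_frob_norm.
rewrite expr2 mulr_suml; apply: ler_sum => i _.
rewrite mulr_suml; apply: ler_sum => j _.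
rewrite -real_normK ?num_real// expr2 ler_wpM2l//.
rewrite (bigD1 i)//= (bigD1 j)//= -addrA lerDl addr_ge0//.
  by apply: sumr_ge0.
by apply: sumr_ge0 => k _; apply: sumr_ge0.
Qed.

Lemma eucl_norm_le_sum {n} (v : 'cV[R]_n) : eucl_norm v <= \sum_i `|v i 0|.
Proof.
rewrite (le_trans (frob_norm_le_sum v))//.
by apply: ler_sum => i _; rewrite big_ord1.
Qed.

Lemma sqr_sum_le {n} (v : 'cV[R]_n) :
  (\sum_i `|v i 0|) ^+ 2 <= n%:R ^+ 2 * eucl_norm v ^+ 2.
Proof.
rewrite -exprMn ler_sqr ?nnegrE ?mulr_ge0 ?frob_norm_ge0//; last first.
  by apply: sumr_ge0.
apply: le_trans (_ : \sum_(i < n) eucl_norm v <= _).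
  by apply: ler_sum => i _; exact: normr_le_frob_norm.
by rewrite sumr_const card_ord mulr_natl.
Qed.

Lemma eucl_norm_mulmx {m n} (A : 'M[R]_(m, n)) (v : 'cV[R]_n) :
  eucl_norm (A *m v) <= (\sum_i \sum_j `|A i j|) * eucl_norm v.
Proof.
rewrite (le_trans (eucl_norm_le_sum _))// mulr_suml; apply: ler_sum => i _.
rewrite mulr_suml mxE (le_trans (ler_norm_sum _ _ _))//; apply: ler_sum => j _.
by rewrite normrM ler_wpM2l// normr_le_frob_norm.
Qed.

Lemma sqr_eucl_normD {n} (u v : 'cV[R]_n) :
  eucl_norm (u + v) ^+ 2 <= 2 * eucl_norm u ^+ 2 + 2 * eucl_norm v ^+ 2.
Proof.
rewrite !sqr_eucl_norm !mulr_sumr -big_split/=; apply: ler_sum => i _.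
rewrite mxE -subr_ge0.
rewrite (_ : _ - _ = (u i 0 - v i 0) ^+ 2) ?sqr_ge0//; ring.
Qed.

Lemma eucl_normZ {n} (a : R) (v : 'cV[R]_n) :
  eucl_norm (a *: v) = `|a| * eucl_norm v.
Proof.
apply/eqP; rewrite -(@eqrXn2 _ 2)// ?mulr_ge0 ?frob_norm_ge0//; apply/eqP.
rewrite exprMn real_normK ?num_real// !sqr_eucl_norm mulr_sumr.
by apply: eq_bigr => i _; rewrite mxE exprMn.
Qed.

Lemma open_exit_radius {p} (P : set 'cV[R]_p) (x : 'cV[R]_p) :
  open P -> P x ->
  exists2 r : R, 0 < r & forall h, ~ P (x + h) -> r <= eucl_norm h.
Proof.
move=> oP Px; have /nbhs_ballP[r /= r0 xrP] : nbhs x P by exact: open_nbhs_nbhs.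
exists r => // h nPh; rewrite leNgt; apply/negP => hr; apply: nPh.
apply: xrP; split=> // i j; rewrite /ball/= mxE opprD addNKr normrN.
exact: le_lt_trans (normr_le_frob_norm _ _ _) hr.
Qed.

End eucl_norm.

Section quadratic_remainder.
Context {R : realType} {p : nat}.
Implicit Types (f : 'cV[R]_p -> R) (P : set 'cV[R]_p) (x h : 'cV[R]_p).

(** The bound holds for all [h], because outside [P] the increment is at least
    the exit radius [r], so that constants and linear terms are dominated by
    [|h|^2]: they get the coefficients [a / r^2] and [d / r] below. *)
Lemma quadratic_remainder f P x (M A : R) :
  open P -> convex_set P -> P x ->
  (forall y, P y -> differentiable f y) ->
  (forall k y, P y -> differentiable (partial k f) y) ->
  (forall k l y, P y -> `|partial l (partial k f) y| <= M) ->
  (forall y, `|f y| <= A * (1 + eucl_norm y ^+ 2)) ->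
  exists c : R, forall h,
    `|f (x + h) - f x - \sum_k h k 0 * partial k f x| <= c * eucl_norm h ^+ 2.
Proof.
move=> oP cP Px df dpf ubM growth.
have [r r0 exitP] := open_exit_radius _ _ oP Px.
have A0 : 0 <= A.
  have := le_trans (normr_ge0 _) (growth 0).
  by rewrite pmulr_lge0// ltr_pwDl// sqr_ge0.
pose d := \sum_k `|partial k f x|.
pose a := A * (1 + 2 * eucl_norm x ^+ 2) + `|f x|.
have d0 : 0 <= d by apply: sumr_ge0.
have a0 : 0 <= a.
  by rewrite addr_ge0// mulr_ge0// addr_ge0// mulr_ge0// sqr_ge0.
exists (`|M| * p%:R ^+ 2 + (a / r ^+ 2 + d / r + 2 * A)) => h.
set N := eucl_norm h; have N0 : 0 <= N := frob_norm_ge0 h.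
have [Pxh|nPxh] := pselect (P (x + h)).
  rewrite (le_trans (taylor1_remainder _ _ _ _ _ cP Px Pxh df dpf ubM))//.
  rewrite (@le_trans _ _ (`|M| * (p%:R ^+ 2 * N ^+ 2)))//.
    rewrite (@le_trans _ _ (`|M| * (\sum_k `|h k 0|) ^+ 2))//.
      by rewrite ler_wpM2r ?sqr_ge0// ler_norm.
    by rewrite ler_wpM2l// sqr_sum_le.
  rewrite mulrA ler_wpM2r ?sqr_ge0// lerDl !addr_ge0//.
  - by rewrite divr_ge0// sqr_ge0.
  - by rewrite divr_ge0// ltW.
  - by rewrite mulr_ge0.
have rN : r <= N := exitP _ nPxh.
have N1 : 1 <= N / r by rewrite ler_pdivlMr// mul1r.
have lin : `|\sum_k h k 0 * partial k f x| <= d * N.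
  rewrite (le_trans (ler_norm_sum _ _ _))// mulr_suml; apply: ler_sum => k _.
  by rewrite normrM mulrC ler_wpM2l// normr_le_frob_norm.
have aN : a <= a / r ^+ 2 * N ^+ 2.
  rewrite [leRHS](_ : _ = a * (N / r) ^+ 2); last by field; rewrite gt_eqF.
  by rewrite ler_peMr// exprn_ege1.
have dN : d * N <= d / r * N ^+ 2.
  rewrite (_ : d / r * N ^+ 2 = d * N * (N / r)); last by rewrite expr2; ring.
  by rewrite ler_peMr// mulr_ge0.
have far : `|f (x + h)| <= A * (1 + 2 * eucl_norm x ^+ 2) + 2 * A * N ^+ 2.
  rewrite (le_trans (growth _))//.
  rewrite [leRHS](_ : _ = A * (1 + (2 * eucl_norm x ^+ 2 + 2 * N ^+ 2))).
    by rewrite ler_wpM2l// lerD2l sqr_eucl_normD.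
  by ring.
rewrite (le_trans (ler_normB _ _))// (le_trans (lerD (ler_normB _ _) lin))//.
have M0 : 0 <= `|M| * p%:R ^+ 2 * N ^+ 2 by rewrite !mulr_ge0// sqr_ge0.
have aE : a = A * (1 + 2 * eucl_norm x ^+ 2) + `|f x| by [].
rewrite 3!mulrDl; lra.
Qed.

End quadratic_remainder.

Section diff_quot_error.
Context {R : realType} {p n : nat}.
Implicit Types (F : 'cV[R]_p -> 'cV[R]_n) (P : set 'cV[R]_p).

(** [Lambda_pred] is diagonal with entries [- g_i / F_i], so multiplying it by
    [F] gives back [- g]: this is where the nonvanishing of [F] is used. *)
Lemma theta_hatE F (dt : R) (th : 'cV[R]_p) (g : 'cV[R]_n) :
  (forall i, F th i 0 != 0) ->
  theta_hat F dt th g = th + dt *: (nabla F th *m g).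
Proof.
move=> F0; rewrite /theta_hat -scalerN; congr (_ + _ *: _).
rewrite -mulmxA -mulmxN /Lambda_pred; congr (_ *m _).
have -> : invmx (diag_mx (F th)^T) = diag_mx (\row_i (F th i 0)^-1).
  set D := diag_mx _; set E := diag_mx _.
  have DE : D *m E = 1%:M.
    apply/matrixP => i j; rewrite mul_diag_mx !mxE.
    by case: eqVneq => [->|_]; rewrite ?mulr1n ?mulr0n ?mulr0// divff.
  have [uD _] := mulmx1_unit DE.
  by rewrite -[LHS]mulmx1 -DE mulKmx.
rewrite -[in LHS]mulmxA.
apply/matrixP => i j; rewrite ord1 !mul_diag_mx !mxE.
by rewrite mulVf// mulr1 opprK.
Qed.

Lemma component_remainder F P (th : 'cV[R]_p) (i : 'I_n) :
  open P -> convex_set P -> P th -> smooth_on P F ->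
  bounded_derivatives_on P F -> quadratic_growth F ->
  exists c : R, forall h,
    `|(F (th + h) - F th - (nabla F th)^T *m h) i 0| <= c * eucl_norm h ^+ 2.
Proof.
move=> oP cP Pth sF bF [A gF].
have /choice[M ubM] (kl : 'I_p * 'I_p) : exists M : R, forall x, P x ->
    `|partial kl.2 (partial kl.1 (component F i)) x| <= M.
  by have [|M hM] := bF i [:: kl.2; kl.1]; [|exists M].
have [|||||||c hc] :=
  @quadratic_remainder R p (component F i) P th (\sum_kl `|M kl|) A.
- exact: oP.
- exact: cP.
- exact: Pth.
- by move=> y Py; exact: (sF i [::]).
- by move=> k y Py; exact: (sF i [:: k]).
- move=> k l y Py; rewrite (le_trans (ubM (k, l) y Py))// (bigD1 (k, l))//=.
  by rewrite (le_trans (ler_norm _))// lerDl sumr_ge0.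
- by move=> y; rewrite (le_trans _ (gF y))// normr_le_frob_norm.
exists c => h; rewrite (le_trans _ (hc h))// !mxE le_eqVlt; apply/orP; left.
apply/eqP; congr (`| _ - _ |); apply: eq_bigr => k _.
by rewrite !mxE mulrC.
Qed.

(** One factor [dt] survives because the remainder is quadratic in
    [h = dt (nabla g)] and is divided by [dt] once. *)
Lemma diff_quot_error F P (th : 'cV[R]_p) :
  open P -> convex_set P -> P th -> smooth_on P F ->
  bounded_derivatives_on P F -> quadratic_growth F ->
  (forall i, F th i 0 != 0) ->
  exists2 c : R, 0 <= c & forall (dt : R) (g : 'cV[R]_n), 0 < dt ->
    eucl_norm (diff_quot F dt th g - ntk F th *m g) <=
      c * dt * eucl_norm g ^+ 2.
Proof.
move=> oP cP Pth sF bF gF F0.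
have /choice[c hc] i := component_remainder F P th i oP cP Pth sF bF gF.
pose L := \sum_k \sum_i `|nabla F th k i|.
exists ((\sum_i `|c i|) * L ^+ 2).
  by rewrite mulr_ge0 ?sqr_ge0// sumr_ge0.
move=> dt g dt0; pose h := dt *: (nabla F th *m g).
have -> : diff_quot F dt th g - ntk F th *m g =
    dt^-1 *: (F (th + h) - F th - (nabla F th)^T *m h).
  rewrite /diff_quot theta_hatE// -/h [RHS]scalerBr /h -scalemxAr scalerA.
  by rewrite mulVf ?gt_eqF// scale1r mulmxA.
rewrite eucl_normZ gtr0_norm ?invr_gt0//.
have hL : eucl_norm h ^+ 2 <= (dt * (L * eucl_norm g)) ^+ 2.
  rewrite ler_sqr ?nnegrE ?frob_norm_ge0//; last first.
    rewrite !mulr_ge0 ?frob_norm_ge0 ?(ltW dt0)//.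
    by do 2 apply: sumr_ge0 => ? _.
  by rewrite eucl_normZ gtr0_norm// ler_wpM2l ?(ltW dt0)// eucl_norm_mulmx.
rewrite [leRHS](_ : _ =
  dt^-1 * ((\sum_i `|c i|) * (dt * (L * eucl_norm g)) ^+ 2)); last first.
  by field; rewrite gt_eqF.
rewrite ler_wpM2l ?invr_ge0 ?(ltW dt0)// (le_trans (eucl_norm_le_sum _))//.
rewrite mulr_suml; apply: ler_sum => i _; rewrite (le_trans (hc i h))//.
rewrite (@le_trans _ _ (`|c i| * eucl_norm h ^+ 2))//.
  by rewrite ler_wpM2r ?sqr_ge0// ler_norm.
by rewrite ler_wpM2l.
Qed.

End diff_quot_error.

(** * Moments of a standard Gaussian vector *)

(** The normal law lives on [measurableTypeR R] and the law of a random variable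
    on [R]: these have the same measurable sets, but different displays make
    them different measurable types.  The image of the normal law under the
    identity is the same law on the second one. *)
Lemma measurable_to_default_display (R : realType) :
  measurable_fun [set: measurableTypeR R] (idfun : measurableTypeR R -> R).
Proof. by move=> _ A mA; rewrite setTI. Qed.

Section standard_normal_variable.
Context {d} {S : measurableType d} {R : realType} (Pr : probability S R).
Variable X : {RV Pr >-> R}.
Local Notation N01 := (@normal_prob R 0 1).
Hypothesis dX : forall B : set R, measurable B -> distribution Pr X B = N01 B.

Let N01R : probability R R := distribution N01
  (HB.pack (idfun : measurableTypeR R -> R)
     (isMeasurableFun.Build _ _ _ _ _ (measurable_to_default_display R))
   : {mfun measurableTypeR R >-> R}).

Lemma integrable_standard_normal_exprn k : (k <= 4)%N ->
  Pr.-integrable [set: S] (fun w => (X w ^+ k)%:E).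
Proof.
move=> k4.
have mk : measurable_fun [set: R] (fun x : R => (x ^+ k)%:E).
  by apply/measurable_EFinP; exact: exprn_measurable.
have mak : measurable_fun [set: R] (fun x : R => `|(x ^+ k)%:E|%E).
  exact: measurableT_comp.
have /integrableP[_ fin] := @integrable_exprn_normal_prob R k k4.
apply/integrableP; split.
  by apply/measurable_EFinP; apply: measurable_funX.
have E : (\int[distribution Pr X]_x `|(x ^+ k)%:E| =
          \int[N01R]_x `|(x ^+ k)%:E|)%E.
  by apply: eq_measure_integral => A mA _; exact: dX.
by rewrite !ge0_integral_distribution in E; rewrite // E.
Qed.

Lemma integral_standard_normal_exprn k : (k <= 4)%N ->
  (\int[Pr]_w (X w ^+ k)%:E = \int[N01]_x (x ^+ k)%:E)%E.
Proof.
move=> k4.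
have mk : measurable_fun [set: R] (fun x : R => (x ^+ k)%:E).
  by apply/measurable_EFinP; exact: exprn_measurable.
have E : (\int[distribution Pr X]_x (x ^+ k)%:E = \int[N01R]_x (x ^+ k)%:E)%E.
  by apply: eq_measure_integral => A mA _; exact: dX.
rewrite integral_distribution// in E; last first.
  exact: integrable_standard_normal_exprn.
by rewrite E integral_distribution//; exact: integrable_exprn_normal_prob.
Qed.

End standard_normal_variable.

Section gaussian_vector.
Context {d} {S : measurableType d} {R : realType} (Pr : probability S R).
Context {n : nat} (X : 'I_n -> {RV Pr >-> R}).
Hypothesis gX : standard_gaussian X.
Local Notation N01 := (@normal_prob R 0 1).

Lemma integrable_gaussian_exprn i k : (k <= 4)%N ->
  Pr.-integrable [set: S] (fun w => (X i w ^+ k)%:E).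
Proof.
by have [_ dX] := gX; exact: (integrable_standard_normal_exprn Pr (X i) (dX i)).
Qed.

Lemma integral_gaussian_exprn i k : (k <= 4)%N ->
  (\int[Pr]_w (X i w ^+ k)%:E = \int[N01]_x (x ^+ k)%:E)%E.
Proof.
by have [_ dX] := gX; exact: (integral_standard_normal_exprn Pr (X i) (dX i)).
Qed.

Lemma integrable_gaussian_mul i j :
  Pr.-integrable [set: S] (fun w => (X i w * X j w)%:E).
Proof.
have := integrableD measurableT (@integrable_gaussian_exprn i 2 isT)
  (@integrable_gaussian_exprn j 2 isT).
apply: le_integrable => //.
  by apply/measurable_EFinP; exact: measurable_funM.
move=> w _; rewrite -EFinD !abse_EFin lee_fin [leRHS]ger0_norm; last first.
  by rewrite addr_ge0// sqr_ge0.
rewrite normrM -(real_normK (num_real (X i w))).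
rewrite -(real_normK (num_real (X j w))).
have := sqr_ge0 (`|X i w| - `|X j w|).
have := normr_ge0 (X i w); have := normr_ge0 (X j w).
nra.
Qed.

Lemma integral_gaussian_mul i j :
  (\int[Pr]_w (X i w * X j w)%:E = (i == j)%:R%:E)%E.
Proof.
have [<-|ij] := eqVneq i j.
  under eq_integral do rewrite -expr2.
  by rewrite integral_gaussian_exprn// normal_prob_second_moment.
have mean k : (\int[Pr]_w (X k w)%:E = 0)%E.
  by rewrite (@integral_gaussian_exprn k 1 isT) normal_prob_mean.
have [indep _] := gX.
rewrite integral_independent_mul ?mean ?mul0e//.
- move=> A B mA mB.
  (* Mutual independence, for the subfamily {i, j}. *)
  pose AB k := if k == i then A else B.
  have mAB k : measurable (AB k) by rewrite /AB; case: ifP.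
  have := indep [set i; j]%SET AB mAB.
  rewrite big_setU1 ?inE//= big_set1 /AB eqxx eq_sym (negbTE ij) => <-.
  congr (Pr _); apply/seteqP; split => [w [Aw Bw] k /=|w /= h].
    by rewrite !inE => /orP[]/eqP->; rewrite ?eqxx// eq_sym (negbTE ij).
  split.
    by have := h i; rewrite /= eqxx; apply; rewrite !inE eqxx.
  by have := h j; rewrite /= eq_sym (negbTE ij); apply; rewrite !inE eqxx orbT.
- exact: (@integrable_gaussian_exprn i 1 isT).
- exact: (@integrable_gaussian_exprn j 1 isT).
- exact: integrable_gaussian_mul.
Qed.

End gaussian_vector.

Section remainder_moments.
Context {d} {S : measurableType d} {R : realType} (Pr : probability S R).
Context {n : nat} (X : 'I_n -> {RV Pr >-> R}).
Hypothesis gX : standard_gaussian X.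

(** Kept unevaluated (it equals 3): it only enters the final constant. *)
Definition normal_fourth_moment : R :=
  fine (\int[@normal_prob R 0 1]_x (x ^+ 4)%:E)%E.
Local Notation m4 := normal_fourth_moment.
Local Notation G w := (eucl_norm (random_vector X w)).

Lemma normal_fourth_moment_ge0 : 0 <= m4.
Proof.
by apply/fine_ge0/integral_ge0 => x _; rewrite lee_fin exprn_even_ge0.
Qed.

Lemma sqr_norm_random_vector w : G w ^+ 2 = \sum_i X i w ^+ 2.
Proof. by rewrite sqr_eucl_norm; apply: eq_bigr => i _; rewrite mxE. Qed.

(** From [2 x^2 y^2 <= x^4 + y^4], applied to all pairs of coordinates. *)
Lemma expr4_norm_random_vector_le w : G w ^+ 4 <= n%:R * \sum_i X i w ^+ 4.
Proof.
rewrite (_ : 4%N = (2 * 2)%N)// exprM sqr_norm_random_vector.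
rewrite expr2 mulr_suml (@le_trans _ _
  (\sum_i \sum_j (2^-1 * X i w ^+ 4 + 2^-1 * X j w ^+ 4)))//.
  apply: ler_sum => i _; rewrite mulr_sumr; apply: ler_sum => j _.
  rewrite -subr_ge0 (_ : _ - _ = 2^-1 * (X i w ^+ 2 - X j w ^+ 2) ^+ 2).
    by rewrite mulr_ge0// sqr_ge0.
  by field.
under eq_bigr do rewrite big_split/= sumr_const card_ord.
rewrite big_split/= sumr_const card_ord sumrMnl -!mulr_sumr.
rewrite -mulrnDl -mulr_natl.
by rewrite le_eqVlt; apply/orP; left; apply/eqP; field.
Qed.

Lemma measurable_sqr_norm_random_vector :
  measurable_fun [set: S] (fun w => G w ^+ 2).
Proof.
rewrite (_ : (fun w => _) = (fun w => \sum_i X i w ^+ 2)); last first.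
  by apply/funext => w; exact: sqr_norm_random_vector.
by apply: measurable_sum => i; exact: measurable_funX.
Qed.

Lemma measurable_expr4_norm_random_vector :
  measurable_fun [set: S] (fun w => G w ^+ 4).
Proof.
rewrite (_ : (fun w => _) = (fun w => (G w ^+ 2) ^+ 2)).
  exact/measurable_funX/measurable_sqr_norm_random_vector.
by apply/funext => w; rewrite -exprM.
Qed.

Lemma integral_sqr_norm : (\int[Pr]_w (G w ^+ 2)%:E = n%:R%:E)%E.
Proof.
under eq_integral do rewrite sqr_norm_random_vector -sumEFin.
rewrite integral_sum//; last by move=> i; exact: integrable_gaussian_exprn.
under eq_bigr do rewrite integral_gaussian_exprn// normal_prob_second_moment.
by rewrite sumEFin sumr_const card_ord.
Qed.

Lemma integral_expr4_norm_le :
  (\int[Pr]_w (G w ^+ 4)%:E <= (n%:R ^+ 2 * m4)%:E)%E.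
Proof.
apply: (@le_trans _ _ (\int[Pr]_w (n%:R * \sum_i X i w ^+ 4)%:E)%E).
  apply: ge0_le_integral => //.
  - by move=> w _; rewrite lee_fin exprn_even_ge0.
  - exact/measurable_EFinP/measurable_expr4_norm_random_vector.
  - apply/measurable_EFinP; apply: measurable_funM => //.
    by apply: measurable_sum => i; exact: measurable_funX.
  - by move=> w _; rewrite lee_fin expr4_norm_random_vector_le.
under eq_integral do rewrite EFinM -sumEFin.
have i4 i := integrable_gaussian_exprn Pr X gX i 4 isT.
rewrite integralZl//; last exact: integrable_sum.
rewrite integral_sum//.
under eq_bigr do rewrite integral_gaussian_exprn//.
have /fineK <- := integrable_fin_num measurableT
  (@integrable_exprn_normal_prob R 4 isT).
rewrite sumEFin sumr_const card_ord -EFinM.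
by rewrite -/m4 -[m4 *+ n]mulr_natl mulrA -expr2.
Qed.

Lemma integrable_expr24_norm :
  Pr.-integrable [set: S] (fun w => (G w ^+ 2 + G w ^+ 4)%:E) /\
  (\int[Pr]_w (G w ^+ 2 + G w ^+ 4)%:E <= (n%:R + n%:R ^+ 2 * m4)%:E)%E.
Proof.
have m2 := measurable_sqr_norm_random_vector.
have mG4 := measurable_expr4_norm_random_vector.
have le24 : (\int[Pr]_w (G w ^+ 2 + G w ^+ 4)%:E <=
             (n%:R + n%:R ^+ 2 * m4)%:E)%E.
  under eq_integral do rewrite EFinD.
  rewrite ge0_integralD//; last 4 first.
  - by move=> w _; rewrite lee_fin sqr_ge0.
  - exact/measurable_EFinP.
  - by move=> w _; rewrite lee_fin exprn_even_ge0.
  - exact/measurable_EFinP.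
  by rewrite integral_sqr_norm EFinD leeD2l// integral_expr4_norm_le.
split=> //; apply/integrableP; split.
  by apply/measurable_EFinP; exact: measurable_funD.
under eq_integral do rewrite abse_EFin ger0_norm ?addr_ge0 ?exprn_even_ge0//.
by apply: le_lt_trans le24 _; rewrite ltry.
Qed.

(** In the rest of the section [e] is any random vector dominated by [b |g|^2];
    it stands for the error of the difference quotient. *)
Variables (e : S -> 'cV[R]_n) (b : R).
Hypotheses (b0 : 0 <= b)
  (me : forall i, measurable_fun [set: S] (fun w => e w i 0))
  (e_le : forall w, eucl_norm (e w) <= b * G w ^+ 2).

Lemma measurable_eucl_norm : measurable_fun [set: S] (fun w => eucl_norm (e w)).
Proof.
rewrite (_ : (fun w => _) = (fun w => Num.sqrt (\sum_i e w i 0 ^+ 2))).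
  apply: (@measurableT_comp _ _ _ _ _ _ (Num.sqrt : R -> R)).
    by apply: continuous_measurable_fun; exact: sqrt_continuous.
  by apply: measurable_sum => i; exact: measurable_funX.
apply/funext => w; congr Num.sqrt.
by apply: eq_bigr => i _; rewrite big_ord1.
Qed.

Lemma expectation_remainder_le :
  ('E_Pr[fun w => eucl_norm (e w)] <= (b * n%:R)%:E)%E.
Proof.
rewrite unlock EFinM -integral_sqr_norm -ge0_integralZl_EFin//; last 2 first.
- by move=> w _; rewrite lee_fin sqr_ge0.
- exact/measurable_EFinP/measurable_sqr_norm_random_vector.
apply: ge0_le_integral => //.
- by move=> w _; rewrite lee_fin frob_norm_ge0.
- exact/measurable_EFinP/measurable_eucl_norm.
- apply/measurable_EFinP; apply: measurable_funM => //.
  exact: measurable_sqr_norm_random_vector.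
- by move=> w _; rewrite -EFinM lee_fin e_le.
Qed.

Lemma expectation_sqr_remainder_le :
  ('E_Pr[fun w => (eucl_norm (e w) ^+ 2)%R]
     <= (b ^+ 2 * (n%:R ^+ 2 * m4))%:E)%E.
Proof.
have mG4 := measurable_expr4_norm_random_vector.
rewrite unlock EFinM.
apply: (@le_trans _ _ ((b ^+ 2)%:E * \int[Pr]_w (G w ^+ 4)%:E)%E); last first.
  by rewrite lee_wpmul2l ?lee_fin ?sqr_ge0// integral_expr4_norm_le.
rewrite -ge0_integralZl_EFin//; last 3 first.
- by move=> w _; rewrite lee_fin exprn_even_ge0.
- exact/measurable_EFinP.
- exact: sqr_ge0.
apply: ge0_le_integral => //.
- by move=> w _; rewrite lee_fin sqr_ge0.
- by apply/measurable_EFinP/measurable_funX/measurable_eucl_norm.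
- by apply/measurable_EFinP; apply: measurable_funM.
move=> w _; rewrite -EFinM lee_fin (_ : _ * _ = (b * G w ^+ 2) ^+ 2).
  by rewrite ler_sqr ?nnegrE ?mulr_ge0 ?frob_norm_ge0// sqr_ge0.
by rewrite exprMn -exprM.
Qed.

(** [|e_i g_j| <= b |g|^3 <= b (|g|^2 + |g|^4)]. *)
Lemma remainder_mul_le i j :
  Pr.-integrable [set: S] (fun w => (e w i 0 * X j w)%:E) /\
  (`| \int[Pr]_w (e w i 0 * X j w)%:E | <= (b * (n%:R + n%:R ^+ 2 * m4))%:E)%E.
Proof.
have [i24 le24] := integrable_expr24_norm.
have dom w : `|e w i 0 * X j w| <= b * (G w ^+ 2 + G w ^+ 4).
  have hX : `|X j w| <= G w.
    by have := normr_le_frob_norm (random_vector X w) j 0; rewrite mxE.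
  have hG : 0 <= G w := frob_norm_ge0 _.
  rewrite normrM (@le_trans _ _ (b * G w ^+ 2 * G w))//.
    by rewrite ler_pM// (le_trans (normr_le_frob_norm _ _ _)).
  rewrite -mulrA ler_wpM2l// -subr_ge0.
  rewrite (_ : _ - _ = 2^-1 * ((G w - G w ^+ 2) ^+ 2 + G w ^+ 2 + G w ^+ 4)).
    by rewrite mulr_ge0// !addr_ge0// ?sqr_ge0// exprn_even_ge0.
  by field.
have meX : measurable_fun [set: S] (fun w => (e w i 0 * X j w)%:E).
  by apply/measurable_EFinP; exact: measurable_funM.
have ieX : Pr.-integrable [set: S] (fun w => (e w i 0 * X j w)%:E).
  apply: (le_integrable measurableT meX _ (integrableZl measurableT b i24)).
  move=> w _; rewrite -EFinM !abse_EFin lee_fin (le_trans (dom w))//.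
  by rewrite ler_norm.
split=> //; apply: le_trans (le_abse_integral _ measurableT meX) _.
rewrite EFinM (@le_trans _ _ (b%:E * \int[Pr]_w (G w ^+ 2 + G w ^+ 4)%:E)%E)//.
  rewrite -integralZl//; apply: ge0_le_integral => //.
  - by apply: measurableT_comp meX.
  - by have /integrableP[] := integrableZl measurableT b i24.
  - by move=> w _; rewrite -EFinM abse_EFin lee_fin.
by rewrite lee_wpmul2l.
Qed.

Variable K : 'M[R]_n.
Local Notation q w := (e w + K *m random_vector X w).

(** [E[(K g) g^T] = K], since the covariance matrix of [g] is the identity. *)
Lemma integral_quotient_mul i j :
  Pr.-integrable [set: S] (fun w => (q w i 0 * X j w)%:E) /\
  (\int[Pr]_w (q w i 0 * X j w)%:E =
   \int[Pr]_w (e w i 0 * X j w)%:E + (K i j)%:E)%E.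
Proof.
have [ieX _] := remainder_mul_le i j.
have iXX k : Pr.-integrable [set: S] (fun w => (K i k * (X k w * X j w))%:E).
  under eq_fun do rewrite EFinM.
  by apply: integrableZl => //; exact: integrable_gaussian_mul.
have E w : ((q w i 0 * X j w)%:E =
    (e w i 0 * X j w)%:E + \sum_k (K i k * (X k w * X j w))%:E)%E.
  rewrite sumEFin -EFinD; congr EFin; rewrite !mxE mulrDl mulr_suml.
  by congr (_ + _); apply: eq_bigr => k _; rewrite mxE mulrA.
have iS : Pr.-integrable [set: S]
    (fun w => \sum_k (K i k * (X k w * X j w))%:E)%E.
  exact: integrable_sum.
split.
  by under eq_fun do rewrite E; exact: integrableD.
under eq_integral do rewrite E.
rewrite integralD//; congr +%E.
rewrite integral_sum//.
have IK k : (\int[Pr]_w (K i k * (X k w * X j w))%:E =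
             (K i k * (k == j)%:R)%:E)%E.
  under eq_integral do rewrite EFinM.
  rewrite integralZl// ?integral_gaussian_mul//.
  exact: integrable_gaussian_mul.
under eq_bigr do rewrite IK.
rewrite sumEFin (bigD1 j)//= eqxx mulr1 big1 ?addr0// => k /negbTE ->.
by rewrite mulr0.
Qed.

(** The estimator [K_hat], written in terms of the error [e]. *)
Definition symmetrized_product (w : S) : 'M[R]_n :=
  2^-1 *: ((q w *m (random_vector X w)^T) + (q w *m (random_vector X w)^T)^T).

(** With [K] symmetric, the deviation from [K] is the mean of [E[e_i g_j]] and
    [E[e_j g_i]]. *)
Lemma symmetrized_product_expectation : K^T = K ->
  mx_integrable Pr symmetrized_product /\
  forall i j, `|mx_expectation Pr symmetrized_product i j - K i j| <=
     b * (n%:R + n%:R ^+ 2 * m4).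
Proof.
move=> symK.
have E i j w : ((symmetrized_product w i j)%:E =
    2^-1%:E * ((q w i 0 * X j w)%:E + (q w j 0 * X i w)%:E))%E.
  rewrite -EFinD -EFinM; congr EFin.
  by rewrite !mxE !big_ord1 !mxE.
have iD i j : Pr.-integrable [set: S]
    (fun w => (q w i 0 * X j w)%:E + (q w j 0 * X i w)%:E)%E.
  apply: integrableD => //; exact: (integral_quotient_mul _ _).1.
have iA : mx_integrable Pr symmetrized_product.
  by move=> i j; under eq_fun do rewrite E; exact: integrableZl.
split=> // i j; rewrite mxE unlock.
under eq_integral do rewrite E.
rewrite integralZl// integralD//; last 2 first.
- exact: (integral_quotient_mul _ _).1.
- exact: (integral_quotient_mul _ _).1.
rewrite (integral_quotient_mul i j).2 (integral_quotient_mul j i).2.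
have [ie1 le1] := remainder_mul_le i j.
have [ie2 le2] := remainder_mul_le j i.
rewrite -(fineK (integrable_fin_num measurableT ie1)) in le1 *.
rewrite -(fineK (integrable_fin_num measurableT ie2)) in le2 *.
move: le1 le2; set s1 := fine _; set s2 := fine _.
rewrite !abse_EFin !lee_fin -!EFinD -EFinM /= => le1 le2.
have -> : K j i = K i j by rewrite -[in LHS]symK mxE.
rewrite (_ : _ - _ = 2^-1 * (s1 + s2)); last by field.
rewrite normrM ger0_norm// ler_pdivrMl//.
rewrite (le_trans (ler_normD _ _))//; lra.
Qed.

End remainder_moments.

(** * The estimator *)

Section measurability.
Context {d} {S : measurableType d} {R : realType} (Pr : probability S R).
Context {p n : nat} (X : 'I_n -> {RV Pr >-> R}).

Lemma measurable_mulmx_random_vector {m} (A : 'M[R]_(m, n)) i :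
  measurable_fun [set: S] (fun w => (A *m random_vector X w) i 0).
Proof.
rewrite (_ : (fun w => _) = (fun w => \sum_j A i j * X j w)); last first.
  by apply/funext => w; rewrite mxE; apply: eq_bigr => j _; rewrite mxE.
by apply: measurable_sum => j; apply: measurable_funM.
Qed.

Lemma measurable_diff_quot_error (F : 'cV[R]_p -> 'cV[R]_n) (dt : R)
    (th : 'cV[R]_p) i :
  borel_measurable F -> (forall i, F th i 0 != 0) ->
  measurable_fun [set: S] (fun w =>
    (diff_quot F dt th (random_vector X w)
       - ntk F th *m random_vector X w) i 0).
Proof.
move=> mF F0.
rewrite (_ : (fun w => _) = (fun w => dt^-1 *
    (component F i (theta_hat F dt th (random_vector X w)) - F th i 0)
    - (ntk F th *m random_vector X w) i 0)); last first.
  by apply/funext => w; rewrite 5!mxE.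
apply: measurable_funB; last exact: measurable_mulmx_random_vector.
apply: measurable_funM => //; apply: measurable_funB => //.
apply: (@measurableT_comp _ _ _ _ (g_sigma_algebraType (@open 'cV[R]_p)) _
  (component F i)) => //.
apply: measurable_cV_open => k.
rewrite (_ : (fun w => _) =
    (fun w => th k 0 + dt * (nabla F th *m random_vector X w) k 0)); last first.
  by apply/funext => w; rewrite theta_hatE// 2!mxE.
apply: measurable_funD => //; apply: measurable_funM => //.
exact: measurable_mulmx_random_vector.
Qed.

End measurability.

Theorem theorem3 (R : realType) (d p nD nB : nat)
  (Om : set 'cV[R]_d)
  (D B : ('cV[R]_d -> R) -> 'cV[R]_d -> R)
  (hD : differential_operator Om D)
  (f gB : 'cV[R]_d -> R)
  (xD : 'I_nD -> 'cV[R]_d) (hxD : forall i, Om (xD i))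
  (xB : 'I_nB -> 'cV[R]_d) (hxB : forall i, boundary_set Om (xB i))
  (u : 'cV[R]_p -> 'cV[R]_d -> R)
  (P : set 'cV[R]_p)
  (res : 'cV[R]_p -> 'cV[R]_(nD + nB))
  (hres : residual_extension P (pinn_residual D B f gB xD xB u) res)
  (T : nat) (theta : 'I_T.+1 -> 'cV[R]_p)
  (htheta : forall t, P (theta t))
  (hres_neq0 : forall (t : 'I_T.+1) (i : 'I_(nD + nB)),
      res (theta t) i 0 != 0)
  (hPopen : open P) (hPconvex : convex_set P) (hPbounded : bounded_set P)
  (hsmooth : smooth_on P res)
  (hbounded : bounded_derivatives_on P res) :
  let n : nat := (nD + nB)%N in
  exists C : R, 0 < C /\
    forall (t : 'I_T.+1) (dt : R), 0 < dt ->
    forall (disp : measure_display) (S : measurableType disp)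
      (Pr : probability S R) (X : 'I_n -> {RV Pr >-> R}),
      standard_gaussian X ->
    let g := random_vector X in
    let th := theta t in
    let err := fun w : S =>
      eucl_norm (diff_quot res dt th (g w) - ntk res th *m g w) in
    let Kh := fun w : S => K_hat res dt th (g w) in
    [/\ ('E_Pr[err] <= (C * n%:R * dt)%:E)%E,
        ('E_Pr[fun w => (err w ^+ 2)%R]
           <= (C ^+ 2 * (n * (n + 2))%:R * dt ^+ 2)%:E)%E,
        mx_integrable Pr Kh /\
        frob_norm (mx_expectation Pr Kh - ntk res th)
          <= C * (n * (n + 1))%:R * dt &
        (`| 'E_Pr[fun w => (\tr (Kh w))%R] - (\tr (ntk res th))%:E |
           <= (C * (n * (n + 1))%:R * dt)%:E)%E].
Proof.
move=> n; have [_ mres growth] := hres.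
have /choice[c hc] t : exists c : R, 0 <= c /\
    forall (dt : R) (g : 'cV[R]_n), 0 < dt ->
    eucl_norm (diff_quot res dt (theta t) g - ntk res (theta t) *m g) <=
      c * dt * eucl_norm g ^+ 2.
  have [c c0 hc] := diff_quot_error res P (theta t) hPopen hPconvex (htheta t)
    hsmooth hbounded growth (hres_neq0 t).
  by exists c.
pose m4 := @normal_fourth_moment R.
have m40 : 0 <= m4 := normal_fourth_moment_ge0.
pose c0 := 1 + \sum_t c t.
have c0_ge1 : 1 <= c0 by rewrite lerDl sumr_ge0// => t _; have [] := hc t.
have c0_gt0 : 0 < c0 by exact: lt_le_trans c0_ge1.
have c0_ge0 := ltW c0_gt0.
have c_le t : c t <= c0.
  rewrite /c0 (bigD1 t)//= addrCA lerDl addr_ge0// sumr_ge0// => s _.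
  by have [] := hc s.
have N0 : 0 <= n%:R :> R by [].
have NN2 : n%:R <= n%:R ^+ 2 :> R.
  by rewrite -natrX ler_nat; case: (n) => // k; rewrite -mulnn leq_pmulr.
(* The factor 1 + m4 pays for the third and fourth moments, and 1 + n^2 for
   bounding the Frobenius norm by the sum of the n^2 entries. *)
exists (c0 * (1 + m4) * (1 + n%:R ^+ 2)); split.
  by apply: mulr_gt0; [apply: mulr_gt0 => //|]; rewrite ltr_pwDl ?sqr_ge0.
move=> t dt dt0 disp S Pr X gX g th err Kh.
set C := c0 * _ * _.
have dt_ge0 : 0 <= dt := ltW dt0.
have [_ hct] := hc t.
pose b := c0 * dt; have b0 : 0 <= b by rewrite mulr_ge0.
pose e w := diff_quot res dt th (g w) - ntk res th *m g w.
have e_le w : eucl_norm (e w) <= b * eucl_norm (g w) ^+ 2.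
  rewrite (le_trans (hct dt (g w) dt0))// ler_wpM2r ?sqr_ge0//.
  by rewrite ler_wpM2r.
have me i : measurable_fun [set: S] (fun w => e w i 0).
  exact: (measurable_diff_quot_error Pr X res dt th i mres (hres_neq0 t)).
have symK : (ntk res th)^T = ntk res th by rewrite /ntk trmx_mul trmxK.
have [iA hA] := symmetrized_product_expectation Pr X gX e b b0 me e_le _ symK.
have KhE : symmetrized_product Pr X e (ntk res th) = Kh.
  apply/funext => w; rewrite /symmetrized_product /Kh /K_hat /e subrK.
  congr (_ *: (_ + _)).
    by apply/matrixP => i j; rewrite !mxE big_ord1 !mxE.
  by congr trmx; apply/matrixP => i j; rewrite !mxE big_ord1 !mxE.
rewrite KhE in iA hA.
set bd := b * _ in hA.
have bd0 : 0 <= bd.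
  by rewrite /bd mulr_ge0// addr_ge0// mulr_ge0// sqr_ge0.
have Bsmall : n%:R ^+ 2 * bd <= C * (n * (n + 1))%:R * dt.
  rewrite [leLHS](_ : _ =
    c0 * dt * (n%:R ^+ 2 * (n%:R + n%:R ^+ 2 * m4))); last first.
    by rewrite /bd /b -/m4; ring.
  rewrite [leRHS](_ : _ =
    c0 * dt * ((1 + n%:R ^+ 2) * ((1 + m4) * (n * (n + 1))%:R))).
    rewrite ler_wpM2l// ler_pM ?sqr_ge0//.
    - by rewrite addr_ge0// mulr_ge0// sqr_ge0.
    - by rewrite lerDr.
    - rewrite natrM natrD mulrDl mul1r lerD//; last first.
        by rewrite mulrC ler_wpM2l// expr2 ler_wpM2l// lerDl.
      by rewrite mulrDr mulr1 lerDr mulr_ge0.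
  by rewrite /C; ring.
have c1_ge0 : 0 <= c0 * (1 + m4) by rewrite mulr_ge0// addr_ge0.
have C_ge : c0 * (1 + m4) <= C by rewrite /C ler_peMr// lerDl sqr_ge0.
split.
- apply: le_trans (expectation_remainder_le Pr X gX e b b0 me e_le) _.
  rewrite lee_fin /b mulrAC ler_wpM2r// ler_wpM2r// (le_trans _ C_ge)//.
  by rewrite ler_peMr// lerDl.
- apply: le_trans (expectation_sqr_remainder_le Pr X gX e b b0 me e_le) _.
  rewrite lee_fin.
  rewrite [leLHS](_ : _ = c0 ^+ 2 * m4 * n%:R ^+ 2 * dt ^+ 2); last first.
    by rewrite /b -/m4; ring.
  rewrite ler_wpM2r ?sqr_ge0// ler_pM ?sqr_ge0//.
  + by rewrite mulr_ge0// sqr_ge0.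
  + apply: (@le_trans _ _ ((c0 * (1 + m4)) ^+ 2)).
      rewrite exprMn ler_wpM2l ?sqr_ge0// -subr_ge0.
      rewrite (_ : _ - _ = 1 + m4 + m4 ^+ 2); last by ring.
      by rewrite !addr_ge0// sqr_ge0.
    by rewrite ler_sqr ?nnegrE// (le_trans c1_ge0).
  + by rewrite natrM natrD expr2 ler_wpM2l// lerDl.
- split=> //; apply: le_trans (frob_norm_le_sum _) _.
  apply: le_trans Bsmall; rewrite expr2 -mulrA.
  apply: le_trans (_ : \sum_(i < n) \sum_(j < n) bd <= _).
    apply: ler_sum => i _; apply: ler_sum => j _.
    have -> (U V : 'M[R]_n) : (U - V) i j = U i j - V i j by rewrite 2!mxE.
    exact: hA.
  by rewrite !sumr_const !card_ord -mulrnA -[leLHS]mulr_natl natrM mulrA.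
- rewrite unlock.
  have iKh i j := integrable_fin_num measurableT (iA i j).
  have -> : (\int[Pr]_w (\tr (Kh w))%:E = (\tr (mx_expectation Pr Kh))%:E)%E.
    under eq_integral do rewrite /mxtrace -sumEFin.
    rewrite integral_sum//.
    rewrite /mxtrace -sumEFin; apply: eq_bigr => i _.
    by rewrite mxE unlock fineK.
  rewrite -EFinD abse_EFin lee_fin (le_trans _ Bsmall)//.
  rewrite /mxtrace -sumrB (le_trans (ler_norm_sum _ _ _))//.
  apply: le_trans (_ : \sum_(i < n) bd <= _); first exact: ler_sum.
  by rewrite sumr_const card_ord -[leLHS]mulr_natl ler_wpM2r.
Qed.
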